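(* Let $\mu$ be a probability measure on $\mathbb{R}^m$ with mean vector $m_0\in\mathbb{R}^m$ and covariance matrix $\Sigma_0\in\mathbb{R}^{m\times m}$ such that $\int\|x\|^4\,d\mu(x)<+\infty$, and let $\nu$ be a probability measure on $\mathbb{R}^n$ with mean vector $m_1\in\mathbb{R}^n$ and covariance matrix $\Sigma_1\in\mathbb{R}^{n\times n}$ such that $\int\|y\|^4\,d\nu(y)<+\infty$. Let $\Sigma_0=P_0D_0P_0^T$ and $\Sigma_1=P_1D_1P_1^T$ be diagonalizations of $\Sigma_0$ and $\Sigma_1$ ($P_0,P_1$ orthogonal, $D_0,D_1$ diagonal). Define $T_0:x\in\mathbb{R}^m\mapsto P_0^T(x-m_0)$ and $T_1:y\in\mathbb{R}^n\mapsto P_1^T(y-m_1)$. Then the problem $$\inf_{\pi\in\Pi(\mu,\nu)}\int\int\left(\|x-x'\|_{\mathbb{R}^m}^2-\|y-y'\|_{\mathbb{R}^n}^2\right)^2d\pi(x,y)\,d\pi(x',y')$$ is equivalent to the problem $$\sup_{X\sim T_0\#\mu,\;Y\sim T_1\#\nu}\ \sum_{i=1}^m\sum_{j=1}^n\mathrm{Cov}(X_i^2,Y_j^2)+2\|\mathrm{Cov}(X,Y)\|_{\mathcal{F}}^2,$$ where $X=(X_1,\dots,X_m)^T$ and $Y=(Y_1,\dots,Y_n)^T$; that is, a coupling $\pi\in\Pi(\mu,\nu)$ attains the infimum in the first problem if and only if the coupling $(T_0,T_1)\#\pi\in\Pi(T_0\#\mu,T_1\#\nu)$, taken as the joint law of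 $(X,Y)$, attains the supremum in the second.
   Context: $\Pi(\mu,\nu)$ denotes the set of probability measures on the product space with marginals $\mu$ and $\nu$. $T\#\mu$ is the push-forward of $\mu$ by $T$; $(T_0,T_1)\#\pi$ is the push-forward of $\pi$ by the map $(x,y)\mapsto(T_0(x),T_1(y))$. The supremum is over all joint laws of $(X,Y)$ (on $\mathbb{R}^m\times\mathbb{R}^n$) with marginals $T_0\#\mu$ and $T_1\#\nu$. $\mathrm{Cov}(X,Y)=\mathbb{E}[(X-\mathbb{E}[X])(Y-\mathbb{E}[Y])^T]\in\mathbb{R}^{m\times n}$, and $\|M\|_{\mathcal{F}}=\sqrt{\mathrm{tr}(M^TM)}$ is the Frobenius norm. $\|\cdot\|_{\mathbb{R}^d}$ is the Euclidean norm on $\mathbb{R}^d$. *)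

(* Defs.v *)
From HB Require Import structures.
From mathcomp Require Import all_boot all_order all_algebra.
From mathcomp Require Import all_classical all_reals all_analysis.

Set Implicit Arguments.
Unset Strict Implicit.
Unset Printing Implicit Defensive.

Import Order.TTheory GRing.Theory Num.Theory.
Import numFieldNormedType.Exports.

Local Open Scope classical_set_scope.
Local Open Scope ring_scope.

(* Matrices, hence the column vectors 'cV[R]_n standing for R^n, carry the
   Borel sigma-algebra of their usual topology. *)
HB.instance Definition _ (R : realType) (m n : nat) :=
  @isMeasurable.Build (sigma_display (@open 'M[R]_(m, n))) 'M[R]_(m, n)
    <<s open>> (@sigma_algebra0 _ setT open) (@sigma_algebraC _ open)
    (@sigma_algebra_bigcup _ setT open).

Lemma continuous_measurable_mx (R : realType) (m n p q : nat)
    (f : 'M[R]_(m, n) -> 'M[R]_(p, q)) :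
  continuous f -> measurable_fun [set: 'M[R]_(m, n)] f.
Proof.
move=> /continuousP cf.
apply: (@measurability _ _ 'M[R]_(m, n) 'M[R]_(p, q) setT f open erefl).
by move=> _ [A oA <-]; rewrite setTI; apply: sub_sigma_algebra; exact: cf.
Qed.

Definition rotate_center (R : realType) (n : nat) (P : 'M[R]_n) (a : 'cV[R]_n)
  (x : 'cV[R]_n) : 'cV[R]_n := P^T *m (x - a).

Lemma continuous_rotate_center (R : realType) (n : nat) (P : 'M[R]_n)
  (a : 'cV[R]_n) : continuous (rotate_center P a).
Proof.
have coord i j : continuous (fun x => rotate_center P a x i j).
  have -> : (fun x => rotate_center P a x i j) =
      (fun x : 'cV[R]_n => \sum_k P k i * (x k j - a k j)).
    by apply/funext => x; rewrite !mxE; apply: eq_bigr => k _; rewrite !mxE.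
  apply: (@continuous_big R^o _ +%R 0 xpredT) => [|k _ x].
    exact: add_continuous.
  apply: (@continuousM _ _ (cst (P k i)) (fun x : 'cV[R]_n => x k j - a k j)).
    exact: cst_continuous.
  apply: (@continuousB _ R^o _ (fun x : 'cV[R]_n => x k j) (cst (a k j))).
    exact: coord_continuous.
  exact: cst_continuous.
move=> x A [B Bx BA].
suff : nbhs x [set y | forall i j, B i j (rotate_center P a y i j)].
  by apply: filterS => y By; exact: BA.
have xF : Filter (nbhs x) := nbhs_filter x.
apply: (filter_forall xF) => i; apply: (filter_forall xF) => j.
exact: (coord i j x (B i j) (Bx i j)).
Qed.

HB.instance Definition _ (R : realType) (n : nat) (P : 'M[R]_n) (a : 'cV[R]_n) :=
  isMeasurableFun.Build _ _ _ _ (rotate_center P a)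
    (continuous_measurable_mx (@continuous_rotate_center R n P a)).

Section product_map.
Context d1 d2 d3 d4 (T1 : measurableType d1) (T2 : measurableType d2)
  (U1 : measurableType d3) (U2 : measurableType d4).

Definition map_pair (f : T1 -> U1) (g : T2 -> U2) (z : T1 * T2) : U1 * U2 :=
  (f z.1, g z.2).

Variables (f : {mfun T1 >-> U1}) (g : {mfun T2 >-> U2}).

Let measurable_map_pair : measurable_fun [set: T1 * T2] (map_pair f g).
Proof.
apply/measurable_fun_pairP; split => /=.
- exact: (measurableT_comp (measurable_funPT f) measurable_fst).
- exact: (measurableT_comp (measurable_funPT g) measurable_snd).
Qed.

HB.instance Definition _ :=
  isMeasurableFun.Build _ _ _ _ (map_pair f g) measurable_map_pair.

End product_map.

Definition coupling d1 d2 (T1 : measurableType d1) (T2 : measurableType d2)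
    (R : realType) (mu : probability T1 R) (nu : probability T2 R) :
    set (probability (T1 * T2)%type R) :=
  [set pi : probability (T1 * T2)%type R |
            (forall A, measurable A -> pushforward pi fst A = mu A) /\
            (forall B, measurable B -> pushforward pi snd B = nu B)].

Definition attains_inf (R : realType) (T : Type) (S : set T)
  (F : T -> \bar R) (x : T) : Prop := S x /\ F x = ereal_inf (F @` S).

Definition attains_sup (R : realType) (T : Type) (S : set T)
  (F : T -> \bar R) (x : T) : Prop := S x /\ F x = ereal_sup (F @` S).

(* Euclidean norm; the library's norm on matrices is the sup norm. *)
Definition enorm (R : realType) (n : nat) (x : 'cV[R]_n) : R :=
  Num.sqrt (\sum_i x i 0 ^+ 2).

Definition frobenius (R : realType) (m n : nat) (M : 'M[R]_(m, n)) : R :=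
  Num.sqrt (\tr (M^T *m M)).

Section expectation_covariance_matrix.
Context d (T : measurableType d) (R : realType) (P : probability T R).

(* Entrywise expectation; an entry without a finite expectation is sent to 0. *)
Definition mx_expectation (m n : nat) (X : T -> 'M[R]_(m, n)) : 'M[R]_(m, n) :=
  \matrix_(i, j) fine 'E_P[fun w => X w i j].

Definition mx_covariance (m n : nat) (X : T -> 'cV[R]_m) (Y : T -> 'cV[R]_n) :
    'M[R]_(m, n) :=
  mx_expectation (fun w => (X w - mx_expectation X) *m
                           (Y w - mx_expectation Y)^T).

End expectation_covariance_matrix.

Section objectives.
Context (R : realType) (m n : nat).
Implicit Type pi : probability ('cV[R]_m * 'cV[R]_n)%type R.
Local Open Scope ereal_scope.

Definition gw_cost pi : \bar R :=
  \int[pi]_z' \int[pi]_z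
    ((enorm (z.1 - z'.1) ^+ 2 - enorm (z.2 - z'.2) ^+ 2) ^+ 2)%:E.

(* pi is the joint law of (X, Y), with X and Y the two projections. *)
Definition cov_objective pi : \bar R :=
  (\sum_(i < m) \sum_(j < n)
     covariance pi (fun z => z.1 i 0 ^+ 2)%R (fun z => z.2 j 0 ^+ 2)%R)
  + (2 * frobenius (mx_covariance pi fst snd) ^+ 2)%:E.

End objectives.

(* Main.v *)
Require Import Defs.
From mathcomp Require Import all_boot all_order all_algebra.
From mathcomp Require Import all_classical all_reals all_analysis.
From mathcomp Require Import measurable_realfun.
From mathcomp Require Import ring lra.

Set Implicit Arguments.
Unset Strict Implicit.
Unset Printing Implicit Defensive.

Import Order.TTheory GRing.Theory Num.Theory.
Import numFieldNormedType.Exports.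

Local Open Scope classical_set_scope.
Local Open Scope ring_scope.

(** The two problems are equivalent because their objectives differ by a
    constant and a negative factor, once both are read on the same set of
    couplings.

    The cost depends on a coupling only through the distances inside each of the
    two spaces. The maps [T0] and [T1] preserve these distances
    ([enorm_rotate_center]), so the cost of a coupling is the cost of its image
    ([gw_cost_isometry]). They are moreover invertible, with inverses of the
    same form ([rotate_centerK]), so taking images is a surjection from the
    couplings of [mu] and [nu] onto those of [T0#mu] and [T1#nu]. It remains to compare
    the cost with the covariance objective on couplings whose marginals are
    centred and have finite fourth moments ([centered_fourth_rotate_center]).

    For such a coupling, list the coordinates of both spaces together as
    functions [X_k], with a sign [e_k] equal to 1 in the first space and to -1
    in the second one. The cost is then the mean of
    [(sum_k e_k (X_k - X_k')^2)^2], where the prime denotes an independent copy,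
    hence a signed sum of means of [(X_k - X_k')^2 (X_l - X_l')^2]. For centred
    [f] and [g], expanding the squares and averaging first over one variable and
    then over the other gives ([is_mean2_sqr_dist])
      [E (f - f')^2 (g - g')^2
         = 2 (E f^2 g^2 + E f^2 E g^2 + 2 (E f g)^2)].
    The terms where [k] and [l] belong to the same space are determined by the
    marginals. In the mixed terms the right-hand side is
    [2 (Cov(f^2, g^2) + 2 Cov(f, g)^2) + 4 E f^2 E g^2], whose last summand is
    again determined by the marginals, and each mixed term occurs twice, with
    sign -1. Summing up, the cost is a constant minus four times the covariance
    objective ([gw_cost_cov_objective]). *)

(** * Finite means and iterated means *)

Section means.
Context d (T : measurableType d) (R : realType).
Implicit Types (P : probability T R) (f g : T -> R).

Definition mean P (f : T -> R) : R := fine 'E_P[f]%E.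

(** The integrability is part of the relation, so that the integral of a linear
    combination can be computed together with the proof that it is finite. *)
Definition is_mean P (f : T -> R) (c : R) : Prop :=
  P.-integrable setT (EFin \o f) /\ (\int[P]_x (f x)%:E = c%:E)%E.

Lemma is_mean_expectation P f c : is_mean P f c -> 'E_P[f]%E = c%:E.
Proof. by case=> _ fc; rewrite unlock. Qed.

Lemma is_mean_mean P f c : is_mean P f c -> mean P f = c.
Proof. by rewrite /mean => /is_mean_expectation->. Qed.

Lemma integrable_is_mean P f :
  P.-integrable setT (EFin \o f) -> is_mean P f (mean P f).
Proof.
move=> intf; split=> //; rewrite /mean unlock fineK //.
exact: integrable_fin_num.
Qed.

Lemma is_mean_eq P f g c : f =1 g -> is_mean P f c -> is_mean P g c.
Proof. by move=> /funext->. Qed.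

Lemma is_mean_cst P (c : R) : is_mean P (fun=> c) c.
Proof.
split; first exact: finite_measure_integrable_cst.
by have := expectation_cst P c; rewrite unlock.
Qed.

Lemma is_meanD P f g (a b : R) :
  is_mean P f a -> is_mean P g b -> is_mean P (fun x => f x + g x) (a + b).
Proof.
move=> [intf fa] [intg gb]; split.
  exact: (@integrableD _ _ _ _ _ measurableT _ _ intf intg).
rewrite EFinD -fa -gb.
exact: (integralD_EFin measurableT intf intg).
Qed.

Lemma is_meanZ P f (k a : R) :
  is_mean P f a -> is_mean P (fun x => k * f x) (k * a).
Proof.
move=> [intf fa]; split.
  exact: (@integrableZl _ _ _ _ _ measurableT k _ intf).
by rewrite EFinM -fa -(integralZl measurableT intf).
Qed.

Lemma is_mean_sum P (I : finType) (f : I -> T -> R) (a : I -> R) :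
  (forall i, is_mean P (f i) (a i)) ->
  is_mean P (fun x => \sum_i f i x) (\sum_i a i).
Proof.
move=> fa; elim: (index_enum I) => [|i s IH].
  rewrite big_nil; under eq_fun do rewrite big_nil.
  exact: is_mean_cst.
rewrite big_cons; under eq_fun do rewrite big_cons.
exact: is_meanD.
Qed.

(** [F z' z] is averaged first over [z] and then over [z']; keeping the inner
    averages finite makes this iterated integral linear in [F]. *)
Definition is_mean2 P (F : T -> T -> R) (c : R) : Prop :=
  exists2 G : T -> R, (forall z', is_mean P (F z') (G z')) & is_mean P G c.

Lemma is_mean2_integral P F c :
  is_mean2 P F c -> (\int[P]_z' \int[P]_z (F z' z)%:E = c%:E)%E.
Proof.
move=> [G FG [_ <-]]; apply: eq_integral => z' _.
by case: (FG z').
Qed.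

Lemma is_mean2Z P F (k a : R) :
  is_mean2 P F a -> is_mean2 P (fun z' z => k * F z' z) (k * a).
Proof.
move=> [G FG Ga]; exists (fun z' => k * G z') => [z'|]; exact: is_meanZ.
Qed.

Lemma is_mean2_sum P (I : finType) (F : I -> T -> T -> R) (a : I -> R) :
  (forall i, is_mean2 P (F i) (a i)) ->
  is_mean2 P (fun z' z => \sum_i F i z' z) (\sum_i a i).
Proof.
move=> Fa.
have /choice[G GP] : forall i, exists G : T -> R,
    (forall z', is_mean P (F i z') (G z')) /\ is_mean P G (a i).
  by move=> i; case: (Fa i) => G ? ?; exists G.
exists (fun z' => \sum_i G i z') => [z'|]; apply: is_mean_sum => i;
  by case: (GP i).
Qed.

End means.

(** * Functions with a finite fourth moment *)

Section fourth_moments.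
Context d (T : measurableType d) (R : realType) (P : probability T R).
Implicit Types f g h k : T -> R.

Definition fourth_moment (f : T -> R) : Prop :=
  measurable_fun setT f /\ P.-integrable setT (fun x => (f x ^+ 4)%:E).

Lemma dominated_integrable f g :
  measurable_fun setT f -> (forall x, `|f x| <= g x) ->
  P.-integrable setT (EFin \o g) -> P.-integrable setT (EFin \o f).
Proof.
move=> mf fg intg; apply: le_integrable intg => //.
  exact/measurable_EFinP.
move=> x _ /=; rewrite lee_fin.
by apply: (le_trans (fg x)); exact: ler_norm.
Qed.

Lemma fourth_moment_cst (c : R) : fourth_moment (fun=> c).
Proof.
split; first exact: measurable_cst.
exact: finite_measure_integrable_cst.
Qed.

Lemma fourth_momentZ (c : R) f :
  fourth_moment f -> fourth_moment (fun x => c * f x).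
Proof.
move=> [mf intf]; split; first exact: measurable_funM.
under eq_fun do rewrite exprMn EFinM.
exact: integrableZl.
Qed.

(** Uses [(a + b)^4 <= 8 (a^4 + b^4)], that is, convexity applied twice. *)
Lemma fourth_momentD f g :
  fourth_moment f -> fourth_moment g -> fourth_moment (fun x => f x + g x).
Proof.
move=> [mf intf] [mg intg]; have mfg := measurable_funD mf mg; split=> //.
apply: (@dominated_integrable _ (fun x => 8 * (f x ^+ 4 + g x ^+ 4))).
- exact: measurable_funX.
- move=> x; rewrite ger0_norm; last by rewrite exprn_even_ge0.
  move: (f x) (g x) => a b.
  have := sqr_ge0 (a ^+ 2 - b ^+ 2); have := sqr_ge0 ((a - b) * (a + b)).
  have := sqr_ge0 ((a - b) * a); have := sqr_ge0 ((a - b) * b).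
  lra.
- apply: (integrableZl measurableT 8 (f := fun x => (f x ^+ 4 + g x ^+ 4)%:E)).
  exact: (integrableD measurableT intf intg).
Qed.

Lemma fourth_moment_sum (I : finType) (f : I -> T -> R) :
  (forall i, fourth_moment (f i)) -> fourth_moment (fun x => \sum_i f i x).
Proof.
move=> f4; elim: (index_enum I) => [|i s IH].
  under eq_fun do rewrite big_nil; exact: fourth_moment_cst.
under eq_fun do rewrite big_cons; exact: fourth_momentD.
Qed.

(** The arithmetic-geometric inequality [4 |abce| <= a^4 + b^4 + c^4 + e^4]
    supplies an integrable bound; shorter products are the case where some
    factors are the constant 1. *)
Lemma integrable_prod4 f g h k :
  fourth_moment f -> fourth_moment g -> fourth_moment h -> fourth_moment k ->
  P.-integrable setT (EFin \o (fun x => f x * g x * h x * k x)).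
Proof.
move=> [mf intf] [mg intg] [mh inth] [mk intk].
apply: (@dominated_integrable _
  (fun x => f x ^+ 4 + g x ^+ 4 + (h x ^+ 4 + k x ^+ 4))).
- by do 3 apply: measurable_funM => //.
- move=> x; rewrite ler_norml; apply/andP.
  move: (f x) (g x) (h x) (k x) => a b c e.
  have := sqr_ge0 (a * b - c * e); have := sqr_ge0 (a * b + c * e).
  have := sqr_ge0 (a ^+ 2 - b ^+ 2); have := sqr_ge0 (c ^+ 2 - e ^+ 2).
  have := sqr_ge0 (a ^+ 2); have := sqr_ge0 (b ^+ 2).
  have := sqr_ge0 (c ^+ 2); have := sqr_ge0 (e ^+ 2).
  split; lra.
- apply: (integrableD measurableT _ _
    (f := fun x => (f x ^+ 4 + g x ^+ 4)%:E)
    (g := fun x => (h x ^+ 4 + k x ^+ 4)%:E)).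
    exact: (integrableD measurableT intf intg).
  exact: (integrableD measurableT inth intk).
Qed.

Lemma fourth_moment_is_mean f : fourth_moment f -> is_mean P f (mean P f).
Proof.
move=> f4; apply: integrable_is_mean.
have one4 := fourth_moment_cst 1.
have := integrable_prod4 f4 one4 one4 one4.
by under eq_fun do rewrite !mulr1.
Qed.

Lemma fourth_moment_is_meanM f g : fourth_moment f -> fourth_moment g ->
  is_mean P (fun x => f x * g x) (mean P (fun x => f x * g x)).
Proof.
move=> f4 g4; apply: integrable_is_mean.
have one4 := fourth_moment_cst 1.
have := integrable_prod4 f4 g4 one4 one4.
by under eq_fun do rewrite !mulr1.
Qed.

Lemma fourth_moment_is_meanM3 f g h : fourth_moment f -> fourth_moment g ->
  fourth_moment h ->
  is_mean P (fun x => f x * g x * h x) (mean P (fun x => f x * g x * h x)).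
Proof.
move=> f4 g4 h4; apply: integrable_is_mean.
have one4 := fourth_moment_cst 1.
have := integrable_prod4 f4 g4 h4 one4.
by under eq_fun do rewrite mulr1.
Qed.

Lemma fourth_moment_is_mean_sqr f : fourth_moment f ->
  is_mean P (fun x => f x ^+ 2) (mean P (fun x => f x ^+ 2)).
Proof. by move=> f4; exact: fourth_moment_is_meanM. Qed.

Lemma fourth_moment_is_mean_sqrM f g : fourth_moment f -> fourth_moment g ->
  is_mean P (fun x => f x ^+ 2 * g x ^+ 2)
    (mean P (fun x => f x ^+ 2 * g x ^+ 2)).
Proof.
move=> f4 g4; apply: integrable_is_mean.
have := integrable_prod4 f4 f4 g4 g4.
by under eq_fun do rewrite -mulrA -!expr2.
Qed.

(** For centred [f] and [g], half of the mean of [(f - f')^2 (g - g')^2], where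
    the prime denotes an independent copy; see [is_mean2_sqr_dist]. *)
Definition dist_correlation (f g : T -> R) : R :=
  mean P (fun x => f x ^+ 2 * g x ^+ 2)
  + mean P (fun x => f x ^+ 2) * mean P (fun x => g x ^+ 2)
  + 2 * mean P (fun x => f x * g x) ^+ 2.

Lemma dist_correlationC f g : dist_correlation f g = dist_correlation g f.
Proof.
have swap a b : mean P (fun x => a x * b x) = mean P (fun x => b x * a x).
  by congr (mean P _); apply/funext => x; rewrite mulrC.
by rewrite /dist_correlation swap [mean P _ * mean P _]mulrC (swap f g).
Qed.

(** Expand into nine monomials; those of degree one in [f] or in [g] at one of
    the two points vanish on averaging over that point. *)
Lemma is_mean2_sqr_dist f g :
  fourth_moment f -> fourth_moment g -> mean P f = 0 -> mean P g = 0 ->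
  is_mean2 P (fun z' z => (f z - f z') ^+ 2 * (g z - g z') ^+ 2)
    (2 * dist_correlation f g).
Proof.
move=> f4 g4 f0 g0; rewrite /dist_correlation.
have Ef := fourth_moment_is_mean f4; rewrite f0 in Ef.
have Eg := fourth_moment_is_mean g4; rewrite g0 in Eg.
have Eff := fourth_moment_is_mean_sqr f4.
have Egg := fourth_moment_is_mean_sqr g4.
have Efg := fourth_moment_is_meanM f4 g4.
have Effg := fourth_moment_is_meanM3 f4 f4 g4.
have Efgg := fourth_moment_is_meanM3 f4 g4 g4.
have E4 := fourth_moment_is_mean_sqrM f4 g4.
(* The inner average over z, as a polynomial in f z' and g z'. *)
exists (fun z' => mean P (fun x => f x ^+ 2 * g x ^+ 2)
  + ((-2 * mean P (fun x => f x * f x * g x)) * g z'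
  + (mean P (fun x => f x ^+ 2) * g z' ^+ 2
  + ((-2 * mean P (fun x => f x * g x * g x)) * f z'
  + ((4 * mean P (fun x => f x * g x)) * (f z' * g z')
  + (mean P (fun x => g x ^+ 2) * f z' ^+ 2
  + f z' ^+ 2 * g z' ^+ 2)))))) => [z'|].
- have := is_meanD E4 (is_meanD (is_meanZ (-2 * g z') Effg)
    (is_meanD (is_meanZ (g z' ^+ 2) Eff)
    (is_meanD (is_meanZ (-2 * f z') Efgg)
    (is_meanD (is_meanZ (4 * (f z' * g z')) Efg)
    (is_meanD (is_meanZ (f z' ^+ 2) Egg)
    (is_meanD (is_meanZ (-2 * (f z' * g z' ^+ 2)) Ef)
    (is_meanD (is_meanZ (-2 * (f z' ^+ 2 * g z')) Eg)
      (is_mean_cst P (f z' ^+ 2 * g z' ^+ 2))))))))).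
  set c := (X in is_mean _ _ X -> _) => Ec; set c' := (X in is_mean _ _ X).
  have -> : c' = c by rewrite /c /c'; ring.
  by apply: is_mean_eq Ec => z /=; ring.
- have := is_meanD (is_mean_cst P (mean P (fun x => f x ^+ 2 * g x ^+ 2)))
    (is_meanD (is_meanZ (-2 * mean P (fun x => f x * f x * g x)) Eg)
    (is_meanD (is_meanZ (mean P (fun x => f x ^+ 2)) Egg)
    (is_meanD (is_meanZ (-2 * mean P (fun x => f x * g x * g x)) Ef)
    (is_meanD (is_meanZ (4 * mean P (fun x => f x * g x)) Efg)
    (is_meanD (is_meanZ (mean P (fun x => g x ^+ 2)) Eff) E4))))).
  set c := (X in is_mean _ _ X -> _) => Ec; set c' := (X in is_mean _ _ X).
  by have -> : c' = c by rewrite /c /c'; ring.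
Qed.

End fourth_moments.

(** * Transport of means along a map *)

Section image_law.
Context d d' (T : measurableType d) (U : measurableType d') (R : realType).

(** Agreement is only asked on measurable sets, since this is all that the
    marginal conditions of a coupling provide. *)
Definition image_law (P : probability T R) (phi : T -> U)
    (Q : probability U R) : Prop :=
  measurable_fun setT phi /\ forall A, measurable A -> Q A = P (phi @^-1` A).

Context (P : probability T R) (phi : T -> U) (Q : probability U R).
Implicit Types f g : U -> R.

(** Integrability is a condition on the integral of the absolute value, which
    transports along [phi] without any integrability assumption. *)
Lemma integrable_image_law f : image_law P phi Q -> measurable_fun setT f ->
  P.-integrable setT (EFin \o (f \o phi)) <-> Q.-integrable setT (EFin \o f).
Proof.
move=> [mphi QP] mf.
have QPabs : (\int[Q]_y `|(EFin \o f) y| =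
    \int[P]_x `|(EFin \o (f \o phi)) x|)%E.
  rewrite (eq_measure_integral (pushforward P phi)); last first.
    by move=> A mA _; exact: QP.
  rewrite ge0_integral_pushforward//.
  by apply: measurableT_comp => //; exact/measurable_EFinP.
split=> /integrableP[_ fin]; apply/integrableP; split.
- exact/measurable_EFinP.
- by rewrite QPabs.
- by apply/measurable_EFinP; exact: measurableT_comp.
- by rewrite -QPabs.
Qed.

Lemma is_mean_image_law f (c : R) :
  image_law P phi Q -> measurable_fun setT f ->
  is_mean P (f \o phi) c <-> is_mean Q f c.
Proof.
move=> PQ mf; have intPQ := integrable_image_law PQ mf.
have [mphi QP] := PQ.
have eqint : P.-integrable setT (EFin \o (f \o phi)) ->
    (\int[Q]_y (f y)%:E = \int[P]_x (f (phi x))%:E)%E.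
  move=> intf; rewrite (eq_measure_integral (pushforward P phi)); last first.
    by move=> A mA _; exact: QP.
  by rewrite integral_pushforward//; exact/measurable_EFinP.
split=> -[intf fc]; split; first exact/intPQ.
- by rewrite eqint.
- exact/intPQ.
- by rewrite -fc eqint//; exact/intPQ.
Qed.

Lemma fourth_moment_image_law f : image_law P phi Q -> measurable_fun setT f ->
  fourth_moment P (f \o phi) <-> fourth_moment Q f.
Proof.
move=> PQ mf; have mphi := PQ.1.
have := integrable_image_law PQ (measurable_funX 4 mf) => intPQ.
split=> -[_ intf]; split=> //; first exact/intPQ.
  exact: measurableT_comp.
exact/intPQ.
Qed.

Lemma mean_image_law f c : image_law P phi Q -> measurable_fun setT f ->
  is_mean P (f \o phi) c -> mean Q f = c.
Proof.
by move=> PQ mf Pf; apply: is_mean_mean; apply/(is_mean_image_law c PQ mf).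
Qed.

Lemma dist_correlation_image_law f g : image_law P phi Q ->
  fourth_moment Q f -> fourth_moment Q g ->
  dist_correlation Q f g = dist_correlation P (f \o phi) (g \o phi).
Proof.
move=> PQ f4 g4; have [mf _] := f4; have [mg _] := g4.
have pf4 := (fourth_moment_image_law PQ mf).2 f4.
have pg4 := (fourth_moment_image_law PQ mg).2 g4.
rewrite /dist_correlation.
have mff := measurable_funX 2 mf; have mgg := measurable_funX 2 mg.
rewrite (mean_image_law PQ mff (fourth_moment_is_mean_sqr pf4)).
rewrite (mean_image_law PQ mgg (fourth_moment_is_mean_sqr pg4)).
rewrite (mean_image_law PQ (measurable_funM mf mg)
  (fourth_moment_is_meanM pf4 pg4)).
by rewrite (mean_image_law PQ (measurable_funM mff mgg)
  (fourth_moment_is_mean_sqrM pf4 pg4)).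
Qed.

End image_law.

(** * Euclidean norms and centred rotations *)

Section euclidean_norm.
Context (R : realType).

Lemma enorm_sqr n (x : 'cV[R]_n) : enorm x ^+ 2 = \sum_i x i 0 ^+ 2.
Proof. by rewrite sqr_sqrtr// sumr_ge0// => i _; exact: sqr_ge0. Qed.

Lemma frobenius_sqr m n (M : 'M[R]_(m, n)) :
  frobenius M ^+ 2 = \sum_i \sum_j M i j ^+ 2.
Proof.
have trE : \tr (M^T *m M) = \sum_i \sum_j M i j ^+ 2.
  rewrite /mxtrace exchange_big; apply: eq_bigr => j _.
  by rewrite mxE; apply: eq_bigr => i _; rewrite mxE -expr2.
rewrite sqr_sqrtr trE// sumr_ge0// => i _; rewrite sumr_ge0// => j _.
exact: sqr_ge0.
Qed.

Lemma enorm_sqr_mul n (x : 'cV[R]_n) : enorm x ^+ 2 = (x^T *m x) 0 0.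
Proof.
by rewrite enorm_sqr mxE; apply: eq_bigr => i _; rewrite mxE -expr2.
Qed.

Lemma enorm_ge0 n (x : 'cV[R]_n) : 0 <= enorm x.
Proof. exact: sqrtr_ge0. Qed.

Lemma measurable_coord m n i j :
  measurable_fun [set: 'M[R]_(m, n)] (fun x : 'M[R]_(m, n) => x i j : R).
Proof.
apply: (measurability _ (RGenOpens.measurableE R)).
move=> _ [_ [a [b ->] <-]]; rewrite setTI; apply: sub_sigma_algebra.
have /continuousP := @coord_continuous R m n i j; apply.
exact: interval_open.
Qed.

Lemma fourth_moment_coord n (mu : probability 'cV[R]_n R) i :
  (\int[mu]_x (enorm x ^+ 4)%:E < +oo)%E ->
  fourth_moment mu (fun x : 'cV[R]_n => x i 0).
Proof.
move=> mu4; split; first exact: measurable_coord.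
have enorm4 (x : 'cV[R]_n) : enorm x ^+ 4 = (\sum_j x j 0 ^+ 2) ^+ 2.
  by rewrite -enorm_sqr -exprM.
apply: (@dominated_integrable _ _ _ _ _ (fun x => enorm x ^+ 4)).
- exact: measurable_funX (measurable_coord i 0).
- move=> x; rewrite ger0_norm ?exprn_even_ge0// enorm4 -[4%N]/(2 * 2)%N exprM.
  rewrite lerXn2r ?nnegrE ?sqr_ge0 ?sumr_ge0// => [j _|]; first exact: sqr_ge0.
  by rewrite (bigD1 i)//= lerDl sumr_ge0// => j _; exact: sqr_ge0.
apply/integrableP; split.
  apply/measurable_EFinP; under eq_fun do rewrite enorm4.
  apply: measurable_funX; apply: measurable_sum => j.
  exact: measurable_funX (measurable_coord j 0).
by under eq_integral do rewrite gee0_abs ?lee_fin ?exprn_ge0 ?enorm_ge0//.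
Qed.

End euclidean_norm.

Section rotate_center.
Context (R : realType) (n : nat).
Implicit Types (P : 'M[R]_n) (a x : 'cV[R]_n).

Lemma rotate_center_coord P a x i :
  rotate_center P a x i 0 = \sum_k P k i * (x k 0 - a k 0).
Proof. by rewrite mxE; apply: eq_bigr => k _; rewrite !mxE. Qed.

Lemma enorm_rotate_center P a x y : P^T *m P = 1%:M ->
  enorm (rotate_center P a x - rotate_center P a y) = enorm (x - y).
Proof.
move=> PP; have {}PP := mulmx1C PP.
apply/eqP; rewrite -(eqrXn2 (n := 2)) ?enorm_ge0//; apply/eqP.
rewrite /rotate_center -mulmxBr opprB addrA subrK.
by rewrite !enorm_sqr_mul trmx_mul trmxK mulmxA -(mulmxA _ P) PP mulmx1.
Qed.

(** [P^T (x - a) = u] means [x = P (u + P^T a)], which is again of the form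
    [rotate_center]. *)
Lemma rotate_centerK P a : P^T *m P = 1%:M ->
  cancel (rotate_center P a) (rotate_center P^T (- (P^T *m a))).
Proof.
move=> /mulmx1C PP x; rewrite /rotate_center trmxK opprK mulmxBr subrK.
by rewrite mulmxA PP mul1mx.
Qed.

Context (mu : probability 'cV[R]_n R).

Lemma fourth_moment_rotate_center P a i :
  (\int[mu]_x (enorm x ^+ 4)%:E < +oo)%E ->
  fourth_moment mu (fun x => rotate_center P a x i 0).
Proof.
move=> mu4; under eq_fun do rewrite rotate_center_coord.
apply: fourth_moment_sum => k; apply: fourth_momentZ.
by apply: fourth_momentD; [exact: fourth_moment_coord|exact: fourth_moment_cst].
Qed.

Lemma is_mean_rotate_center P i :
  (\int[mu]_x (enorm x ^+ 4)%:E < +oo)%E ->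
  is_mean mu (fun x => rotate_center P (mx_expectation mu id) x i 0) 0.
Proof.
move=> mu4; under eq_fun do rewrite rotate_center_coord.
rewrite [X in is_mean _ _ X](_ : 0 = \sum_(k < n) P k i * 0); last first.
  by rewrite big1// => k _; rewrite mulr0.
apply: is_mean_sum => k; apply: is_meanZ.
rewrite mxE -(subrr (mean mu (fun x => x k 0))).
apply: is_meanD; last exact: is_mean_cst.
exact: fourth_moment_is_mean (fourth_moment_coord _ mu4).
Qed.

End rotate_center.

(** * The two objectives in terms of moments *)

Section costs.
Context (R : realType) (m n : nat).
Local Notation Z := ('cV[R]_m * 'cV[R]_n)%type.

(** Listing the coordinates of both spaces over one index type turns the
    difference of squared distances into a single signed sum. *)
Definition pair_coord (k : 'I_m + 'I_n) (z : Z) : R :=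
  match k with inl i => z.1 i 0 | inr j => z.2 j 0 end.

Definition coord_sign (k : 'I_m + 'I_n) : R := if k is inl _ then 1 else -1.

Lemma sum_coord_sign (F : 'I_m + 'I_n -> 'I_m + 'I_n -> R) :
  (forall k l, F k l = F l k) ->
  \sum_k \sum_l coord_sign k * coord_sign l * F k l =
  \sum_i \sum_i' F (inl i) (inl i') + \sum_j \sum_j' F (inr j) (inr j')
  - 2 * \sum_i \sum_j F (inl i) (inr j).
Proof.
move=> FC; rewrite big_sumType/=.
have -> : \sum_i \sum_l 1 * coord_sign l * F (inl i) l =
    \sum_i \sum_i' F (inl i) (inl i') - \sum_i \sum_j F (inl i) (inr j).
  rewrite -sumrB; apply: eq_bigr => i _; rewrite big_sumType/= -sumrN.
  by congr +%R; apply: eq_bigr => l _; rewrite ?mulr1 ?mul1r ?mulN1r.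
have -> : \sum_j \sum_l -1 * coord_sign l * F (inr j) l =
    \sum_j \sum_j' F (inr j) (inr j') - \sum_i \sum_j F (inl i) (inr j).
  rewrite [X in _ - X]exchange_big -sumrB; apply: eq_bigr => j _.
  rewrite big_sumType/= addrC -sumrN.
  congr +%R; apply: eq_bigr => l _; first by rewrite mulrNN !mul1r.
  by rewrite mulr1 mulN1r FC.
ring.
Qed.

Lemma measurable_pair_coord k : measurable_fun setT (pair_coord k).
Proof.
case: k => i /=.
  exact: (measurableT_comp (measurable_coord i 0) measurable_fst).
exact: (measurableT_comp (measurable_coord i 0) measurable_snd).
Qed.

Lemma sqr_dist_diff_pair_coord (z z' : Z) :
  enorm (z.1 - z'.1) ^+ 2 - enorm (z.2 - z'.2) ^+ 2 =
  \sum_k coord_sign k * (pair_coord k z - pair_coord k z') ^+ 2.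
Proof.
rewrite !enorm_sqr big_sumType/= -sumrN; congr +%R; apply: eq_bigr => i _.
  by rewrite !mxE mul1r.
by rewrite !mxE mulN1r.
Qed.

Definition centered_fourth (rho : probability Z R) : Prop :=
  forall k, fourth_moment rho (pair_coord k) /\ mean rho (pair_coord k) = 0.

Lemma gw_cost_centered (rho : probability Z R) : centered_fourth rho ->
  gw_cost rho = (2 *
    (\sum_i \sum_i'
       dist_correlation rho (pair_coord (inl i)) (pair_coord (inl i'))
     + \sum_j \sum_j'
         dist_correlation rho (pair_coord (inr j)) (pair_coord (inr j'))
     - 2 * \sum_i \sum_j
         dist_correlation rho (pair_coord (inl i)) (pair_coord (inr j))))%:E.
Proof.
move=> rho4.
pose F k l := dist_correlation rho (pair_coord k) (pair_coord l).
have FC k l : F k l = F l k := dist_correlationC _ _ _.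
rewrite -(sum_coord_sign FC).
rewrite mulr_sumr; under eq_bigr do rewrite mulr_sumr.
under eq_bigr do under eq_bigr do rewrite mulrCA.
apply: is_mean2_integral.
rewrite (_ : (fun _ _ => _) = fun z' z => \sum_k \sum_l
    coord_sign k * coord_sign l *
    ((pair_coord k z - pair_coord k z') ^+ 2 *
     (pair_coord l z - pair_coord l z') ^+ 2)); last first.
  apply/funext => z'; apply/funext => z.
  rewrite sqr_dist_diff_pair_coord expr2 big_distrlr/=.
  by apply: eq_bigr => k _; apply: eq_bigr => l _; rewrite mulrACA.
apply: is_mean2_sum => k; apply: is_mean2_sum => l; apply: is_mean2Z.
by have [[k4 k0] [l4 l0]] := (rho4 k, rho4 l); exact: is_mean2_sqr_dist.
Qed.

Lemma covariance_sqr (rho : probability Z R) f g :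
  fourth_moment rho f -> fourth_moment rho g ->
  covariance rho (fun z => f z ^+ 2) (fun z => g z ^+ 2) =
  (mean rho (fun z => f z ^+ 2 * g z ^+ 2)
   - mean rho (fun z => f z ^+ 2) * mean rho (fun z => g z ^+ 2))%:E.
Proof.
move=> f4 g4.
have Eff := fourth_moment_is_mean_sqr f4.
have Egg := fourth_moment_is_mean_sqr g4.
have E4 := fourth_moment_is_mean_sqrM f4 g4.
rewrite unlock; apply: is_mean_expectation.
have := is_meanD E4 (is_meanD (is_meanZ (- mean rho (fun z => g z ^+ 2)) Eff)
  (is_meanD (is_meanZ (- mean rho (fun z => f z ^+ 2)) Egg)
  (is_mean_cst rho (mean rho (fun z => f z ^+ 2) *
    mean rho (fun z => g z ^+ 2))))).
set c := (X in is_mean _ _ X -> _) => Ec; set c' := (X in is_mean _ _ X).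
have -> : c' = c by rewrite /c /c'; ring.
by apply: is_mean_eq Ec => z; rewrite mulrfctE /= /mean; ring.
Qed.

Lemma mx_covariance_centered (rho : probability Z R) i j :
  centered_fourth rho ->
  mx_covariance rho fst snd i j =
  mean rho (fun z => pair_coord (inl i) z * pair_coord (inr j) z).
Proof.
move=> rho4.
have E0 : mx_expectation rho fst = 0 :> 'cV[R]_m.
  by apply/matrixP => k l; rewrite !mxE ord1; exact: (rho4 (inl k)).2.
have E1 : mx_expectation rho snd = 0 :> 'cV[R]_n.
  by apply/matrixP => k l; rewrite !mxE ord1; exact: (rho4 (inr k)).2.
rewrite /mx_covariance E0 E1 mxE /mean; congr (fine 'E_rho[_]%E).
by apply/funext => z; rewrite !subr0 mxE big_ord1 mxE.
Qed.

Lemma cov_objective_centered (rho : probability Z R) : centered_fourth rho ->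
  cov_objective rho =
  (\sum_i \sum_j (dist_correlation rho (pair_coord (inl i)) (pair_coord (inr j))
    - 2 * (mean rho (fun z => pair_coord (inl i) z ^+ 2) *
           mean rho (fun z => pair_coord (inr j) z ^+ 2))))%:E.
Proof.
move=> rho4; rewrite /cov_objective frobenius_sqr.
have covE i j : covariance rho (fun z : Z => z.1 i 0 ^+ 2)
    (fun z : Z => z.2 j 0 ^+ 2) = _ :=
  covariance_sqr (rho4 (inl i)).1 (rho4 (inr j)).1.
under eq_bigr do under eq_bigr do rewrite covE.
under eq_bigr do rewrite sumEFin.
rewrite sumEFin -EFinD mulr_sumr -big_split; congr EFin.
apply: eq_bigr => i _; rewrite mulr_sumr -big_split; apply: eq_bigr => j _ /=.
by rewrite mx_covariance_centered// /dist_correlation; ring.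
Qed.

End costs.

(** * Couplings *)

Definition centered_fourth_marginal (R : realType) n
    (mu : probability 'cV[R]_n R) : Prop :=
  forall i, fourth_moment mu (fun x => x i 0) /\ mean mu (fun x => x i 0) = 0.

Lemma centered_fourth_rotate_center (R : realType) n
    (mu : probability 'cV[R]_n R) (P : 'M[R]_n) :
  (\int[mu]_x (enorm x ^+ 4)%:E < +oo)%E ->
  centered_fourth_marginal
    (distribution mu (rotate_center P (mx_expectation mu id))).
Proof.
move=> mu4 i; set T := (X in distribution _ X).
have law : image_law mu T (distribution mu T).
  by split=> //; exact: measurable_funPT.
have mi := @measurable_coord R n 1 i 0.
split; first by apply/(fourth_moment_image_law law mi);
  exact: fourth_moment_rotate_center.
exact: (mean_image_law law mi (is_mean_rotate_center P i mu4)).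
Qed.

Section couplings.
Context d1 d2 (T1 : measurableType d1) (T2 : measurableType d2) (R : realType).
Context (mu : probability T1 R) (nu : probability T2 R)
  (pi : probability (T1 * T2)%type R).
Context (coupling_pi : coupling mu nu pi).

Lemma image_law_fst : image_law pi fst mu.
Proof. by split=> [|A mA]; [exact: measurable_fst|rewrite -coupling_pi.1]. Qed.

Lemma image_law_snd : image_law pi snd nu.
Proof. by split=> [|A mA]; [exact: measurable_snd|rewrite -coupling_pi.2]. Qed.

Lemma coupling_distribution d3 d4 (U1 : measurableType d3)
    (U2 : measurableType d4) (f : {mfun T1 >-> U1}) (g : {mfun T2 >-> U2}) :
  coupling (distribution mu f) (distribution nu g)
    (distribution pi (map_pair f g)).
Proof.
split=> A mA.
  have mfA : measurable (f @^-1` A).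
    by rewrite -[_ @^-1` _]setTI; exact: measurable_funPT.
  exact: (coupling_pi.1 _ mfA).
have mgA : measurable (g @^-1` A).
  by rewrite -[_ @^-1` _]setTI; exact: measurable_funPT.
exact: (coupling_pi.2 _ mgA).
Qed.

End couplings.

Section objectives_on_couplings.
Context (R : realType) (m n : nat).
Context (mu : probability 'cV[R]_m R) (nu : probability 'cV[R]_n R).
Context (mu4 : centered_fourth_marginal mu)
  (nu4 : centered_fourth_marginal nu).

Lemma centered_fourth_coupling rho :
  coupling mu nu rho -> centered_fourth rho.
Proof.
move=> cpl [i|j].
- have law := image_law_fst cpl; have mi := @measurable_coord R m 1 i 0.
  have [i4 i0] := mu4 i.
  have fi4 := (fourth_moment_image_law law mi).2 i4; split=> //.
  by rewrite -i0 (mean_image_law law mi (fourth_moment_is_mean fi4)).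
- have law := image_law_snd cpl; have mj := @measurable_coord R n 1 j 0.
  have [j4 j0] := nu4 j.
  have sj4 := (fourth_moment_image_law law mj).2 j4; split=> //.
  by rewrite -j0 (mean_image_law law mj (fourth_moment_is_mean sj4)).
Qed.

(** Only the correlations between a coordinate of the first space and one of the
    second vary with the coupling, and they enter the cost with factor -4 and
    the covariance objective with factor 1. *)
Lemma gw_cost_cov_objective : exists C : R, forall rho, coupling mu nu rho ->
  exists2 c : R, cov_objective rho = c%:E & gw_cost rho = (C - 4 * c)%:E.
Proof.
pose sq k (p : probability 'cV[R]_k R) i := mean p (fun x => x i 0 ^+ 2).
pose corr k (p : probability 'cV[R]_k R) i j :=
  dist_correlation p (fun x => x i 0) (fun x => x j 0).
exists (2 * (\sum_i \sum_j corr m mu i j + \sum_i \sum_j corr n nu i j)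
  - 8 * \sum_i \sum_j sq m mu i * sq n nu j) => rho cpl.
have rho4 := centered_fourth_coupling cpl.
have law1 := image_law_fst cpl; have law2 := image_law_snd cpl.
rewrite cov_objective_centered//; eexists; first by [].
rewrite gw_cost_centered//; congr EFin.
have sq1 i : mean rho (fun z => pair_coord (inl i) z ^+ 2) = sq m mu i.
  apply/esym/(mean_image_law law1 (measurable_funX 2 (measurable_coord i 0))).
  exact: fourth_moment_is_mean_sqr (rho4 (inl i)).1.
have sq2 j : mean rho (fun z => pair_coord (inr j) z ^+ 2) = sq n nu j.
  apply/esym/(mean_image_law law2 (measurable_funX 2 (measurable_coord j 0))).
  exact: fourth_moment_is_mean_sqr (rho4 (inr j)).1.
have corr1 i i' : corr m mu i i' =
    dist_correlation rho (pair_coord (inl i)) (pair_coord (inl i')).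
  exact: (dist_correlation_image_law law1 (mu4 i).1 (mu4 i').1).
have corr2 j j' : corr n nu j j' =
    dist_correlation rho (pair_coord (inr j)) (pair_coord (inr j')).
  exact: (dist_correlation_image_law law2 (nu4 j).1 (nu4 j').1).
pose cross := \sum_i \sum_j
  dist_correlation rho (pair_coord (inl i)) (pair_coord (inr j)).
have -> : \sum_i \sum_j
    (dist_correlation rho (pair_coord (inl i)) (pair_coord (inr j))
    - 2 * (mean rho (fun z => pair_coord (inl i) z ^+ 2) *
           mean rho (fun z => pair_coord (inr j) z ^+ 2))) =
    cross - 2 * \sum_i \sum_j sq m mu i * sq n nu j.
  rewrite mulr_sumr -sumrB; apply: eq_bigr => i _.
  rewrite mulr_sumr -sumrB; apply: eq_bigr => j _.
  by rewrite sq1 sq2.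
under eq_bigr do under eq_bigr do rewrite -corr1.
under [X in _ + X - _]eq_bigr do under eq_bigr do rewrite -corr2.
rewrite -/cross; ring.
Qed.

End objectives_on_couplings.

(** The integrand depends on the two points through their distances alone. As it
    is nonnegative, a change of variables in each of the two integrals requires
    only measurability, which for the inner integral is part of the Tonelli
    theorem. *)
Lemma gw_cost_isometry (R : realType) m n
    (pi : probability ('cV[R]_m * 'cV[R]_n)%type R)
    (f : {mfun 'cV[R]_m >-> 'cV[R]_m}) (g : {mfun 'cV[R]_n >-> 'cV[R]_n}) :
  (forall x x', enorm (f x - f x') = enorm (x - x')) ->
  (forall y y', enorm (g y - g y') = enorm (y - y')) ->
  gw_cost (distribution pi (map_pair f g)) = gw_cost pi.
Proof.
move=> isof isog; rewrite /gw_cost.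
pose F z' z : \bar R := ((enorm ((z : 'cV[R]_m * 'cV[R]_n).1 - z'.1) ^+ 2
  - enorm (z.2 - z'.2) ^+ 2) ^+ 2)%:E.
have F0 z' z : (0 <= F z' z)%E by rewrite lee_fin sqr_ge0.
have mF : measurable_fun setT (fun zz => F zz.1 zz.2).
  apply/measurable_EFinP; under eq_fun do rewrite sqr_dist_diff_pair_coord.
  apply: measurable_funX; apply: measurable_sum => k.
  apply: measurable_funM => //; apply: measurable_funX; apply: measurable_funB.
    exact: (measurableT_comp (measurable_pair_coord k) measurable_snd).
  exact: (measurableT_comp (measurable_pair_coord k) measurable_fst).
have mphi : measurable_fun setT (map_pair f g) := measurable_funPT _.
have mFz z' : measurable_fun setT (F z').
  exact: (measurableT_comp mF (pair1_measurable z')).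
pose rho : probability _ R := distribution pi (map_pair f g).
pose G z' : \bar R := (\int[rho]_z F z' z)%E.
have mG : measurable_fun setT G.
  exact: (measurable_fun_fubini_tonelli_F
    (fun zz => F zz.1 zz.2) mF (fun zz => F0 zz.1 zz.2)).
have G0 z' : (0 <= G z')%E by apply: integral_ge0 => z _; exact: F0.
transitivity (\int[pi]_z' G (map_pair f g z'))%E.
  exact: (ge0_integral_pushforward mphi pi measurableT mG (fun z' _ => G0 z')).
apply: eq_integral => z' _.
rewrite /G (ge0_integral_pushforward mphi pi measurableT (mFz _)); last first.
  by move=> z _; exact: F0.
by apply: eq_integral => z _; rewrite /F /= isof isog.
Qed.

(** * Equivalence of the two problems *)

Lemma attains_infP (R : realType) (T : Type) (S : set T) (F : T -> \bar R) x :
  S x -> attains_inf S F x <-> (forall y, S y -> F x <= F y)%E.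
Proof.
move=> Sx; split=> [[_ ->] y Sy|minx].
  by apply: ereal_inf_lbound; exists y.
split=> //; apply/eqP; rewrite eq_le; apply/andP; split.
  by apply: le_ereal_inf_tmp => _ [y Sy <-]; exact: minx.
by apply: ereal_inf_lbound; exists x.
Qed.

Lemma attains_supP (R : realType) (T : Type) (S : set T) (F : T -> \bar R) x :
  S x -> attains_sup S F x <-> (forall y, S y -> F y <= F x)%E.
Proof.
move=> Sx; split=> [[_ ->] y Sy|maxx].
  by apply: ereal_sup_ubound; exists y.
split=> //; apply/eqP; rewrite eq_le; apply/andP; split.
  by apply: ereal_sup_ubound; exists x.
by apply: ge_ereal_sup => _ [y Sy <-]; exact: maxx.
Qed.

Theorem theorem2p1 (R : realType) (m n : nat)
  (mu : probability 'cV[R]_m R) (nu : probability 'cV[R]_n R)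
  (m0 : 'cV[R]_m) (Sigma0 : 'M[R]_m) (m1 : 'cV[R]_n) (Sigma1 : 'M[R]_n)
  (mu4 : (\int[mu]_x (enorm x ^+ 4)%:E < +oo)%E)
  (nu4 : (\int[nu]_y (enorm y ^+ 4)%:E < +oo)%E)
  (mean_mu : mx_expectation mu id = m0)
  (mean_nu : mx_expectation nu id = m1)
  (cov_mu : mx_covariance mu id id = Sigma0)
  (cov_nu : mx_covariance nu id id = Sigma1)
  (P0 D0 : 'M[R]_m) (P1 D1 : 'M[R]_n)
  (orthogonal_P0 : P0^T *m P0 = 1%:M) (orthogonal_P1 : P1^T *m P1 = 1%:M)
  (diagonal_D0 : is_diag_mx D0) (diagonal_D1 : is_diag_mx D1)
  (diag_Sigma0 : Sigma0 = P0 *m D0 *m P0^T)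
  (diag_Sigma1 : Sigma1 = P1 *m D1 *m P1^T)
  (T0 : {mfun 'cV[R]_m >-> 'cV[R]_m} := rotate_center P0 m0)
  (T1 : {mfun 'cV[R]_n >-> 'cV[R]_n} := rotate_center P1 m1)
  (T0mu : probability 'cV[R]_m R := distribution mu T0)
  (T1nu : probability 'cV[R]_n R := distribution nu T1)
  (pi : probability ('cV[R]_m * 'cV[R]_n)%type R)
  (T01pi : probability ('cV[R]_m * 'cV[R]_n)%type R :=
     distribution pi (map_pair T0 T1)) :
  coupling mu nu pi ->
  coupling T0mu T1nu T01pi /\
  (attains_inf (coupling mu nu) (@gw_cost R m n) pi <->
   attains_sup (coupling T0mu T1nu) (@cov_objective R m n) T01pi).
Proof.
move=> cpl; have cplT : coupling T0mu T1nu T01pi.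
  exact: coupling_distribution.
split=> //.
(* The inverses of T0 and T1, which are again centred rotations. *)
pose S0 : {mfun 'cV[R]_m >-> 'cV[R]_m} :=
  rotate_center P0^T (- (P0^T *m m0)).
pose S1 : {mfun 'cV[R]_n >-> 'cV[R]_n} :=
  rotate_center P1^T (- (P1^T *m m1)).
have T0iso x x' : enorm (T0 x - T0 x') = enorm (x - x').
  exact: enorm_rotate_center.
have T1iso y y' : enorm (T1 y - T1 y') = enorm (y - y').
  exact: enorm_rotate_center.
have S0iso x x' : enorm (S0 x - S0 x') = enorm (x - x').
  by apply: enorm_rotate_center; rewrite trmxK; exact: mulmx1C.
have S1iso y y' : enorm (S1 y - S1 y') = enorm (y - y').
  by apply: enorm_rotate_center; rewrite trmxK; exact: mulmx1C.
(* Since S0 and S1 undo T0 and T1 on the marginals, every competitor in the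
   second problem yields one in the first problem, with the same cost. *)
have cplS rho : coupling T0mu T1nu rho ->
    coupling mu nu (distribution rho (map_pair S0 S1)).
  move=> cplrho; have [rho1 rho2] := coupling_distribution cplrho S0 S1.
  split=> A mA.
    rewrite rho1//=; congr (mu _); apply/seteqP; split=> x;
    by rewrite /preimage/= rotate_centerK.
  rewrite rho2//=; congr (nu _); apply/seteqP; split=> y;
  by rewrite /preimage/= rotate_centerK.
have mu0 : centered_fourth_marginal T0mu.
  by rewrite /T0mu /T0 -mean_mu; exact: centered_fourth_rotate_center.
have nu0 : centered_fourth_marginal T1nu.
  by rewrite /T1nu /T1 -mean_nu; exact: centered_fourth_rotate_center.
have [C costE] := gw_cost_cov_objective mu0 nu0.
(* The negative factor -4 reverses the order of the couplings. *)
have gw_le rho rho' : coupling T0mu T1nu rho -> coupling T0mu T1nu rho' ->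
    (gw_cost rho <= gw_cost rho')%E =
    (cov_objective rho' <= cov_objective rho)%E.
  move=> /costE[c -> ->] /costE[c' -> ->].
  by rewrite !lee_fin lerD2l lerN2 ler_pM2l.
rewrite (attains_infP _ cpl) (attains_supP _ cplT).
split=> [minpi rho cplrho|maxpi sigma cpls].
- rewrite -(gw_le _ _ cplT cplrho) (gw_cost_isometry pi T0iso T1iso).
  by rewrite -(gw_cost_isometry rho S0iso S1iso); exact/minpi/cplS.
- rewrite -(gw_cost_isometry pi T0iso T1iso).
  rewrite -(gw_cost_isometry sigma T0iso T1iso).
  have cplTs := coupling_distribution cpls T0 T1.
  by rewrite (gw_le _ _ cplT cplTs); exact: maxpi cplTs.
Qed.
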